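(* Let $K \in \mathbb{R}^{n\times n}$ be a rate constant matrix with stationary distribution $\pi \in \Delta_n^\circ$ and let $\{S,T\}$ be a bipartition of $[n]$ with $K_{SS}$ nonsingular. Let $M := I_T + K_{TS}K_{SS}^{-2}K_{ST} \in \mathbb{R}^{T\times T}$. Let $V \in \mathbb{R}^{n\times n}$ be of the form (with blocks ordered $S,T$) $$V = \begin{pmatrix} K_{SS}^{-1} K_{ST} V_{TT} K_{TS} K_{SS}^{-1} & -K_{SS}^{-1} K_{ST} V_{TT} \\ -V_{TT} K_{TS} K_{SS}^{-1} & V_{TT} \end{pmatrix}$$ for some $V_{TT} \in \mathbb{R}^{T\times T}$. Then the following hold. 1. $V$ is entrywise non-negative if and only if $V_{TT}$ is entrywise non-negative. 2. $\mathbf{1}_n^\top V = \mathbf{1}_n^\top$ if and only if $\mathbf{1}_T^\top M V_{TT} = \mathbf{1}_T^\top$.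
   Context: $[n] = \{1,\dotsc,n\}$. $\Delta_n^\circ = \{y \in \mathbb{R}_{>0}^n : \sum_i y_i = 1\}$. A rate constant matrix with stationary distribution $\pi \in \Delta_n^\circ$ is a matrix $K \in \mathbb{R}^{n\times n}$ such that $K_{ij} \ge 0$ for $i \ne j$, every column of $K$ sums to $0$, and $K_{ij}\pi_j = K_{ji}\pi_i$ for all $i,j$. A bipartition $\{S,T\}$ of $[n]$ is a pair of disjoint nonempty sets with $S \cup T = [n]$; $A_{IJ}$ denotes the submatrix of $A$ with rows $I$ and columns $J$, $K_{SS}^{-1} = (K_{SS})^{-1}$, $K_{SS}^{-2} = (K_{SS}^{-1})^2$. $\mathbf{1}_n$ and $\mathbf{1}_T$ are the all-one vectors in $\mathbb{R}^n$ and $\mathbb{R}^T$, and $I_T$ is the identity matrix in $\mathbb{R}^{T\times T}$. *)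

(* Defs.v *)
From mathcomp Require Import all_boot all_order all_algebra.
From mathcomp Require Import reals.

Set Implicit Arguments.
Unset Strict Implicit.
Unset Printing Implicit Defensive.

Import Order.TTheory GRing.Theory Num.Theory.
Local Open Scope ring_scope.


Definition in_open_simplex (R : realType) (n : nat) (y : 'cV[R]_n) : Prop :=
  (forall i, 0 < y i 0) /\ \sum_i y i 0 = 1.

Definition rate_constant_matrix (R : realType) (n : nat)
    (K : 'M[R]_n) (pi : 'cV[R]_n) : Prop :=
  [/\ forall i j, i != j -> 0 <= K i j,
      forall j, \sum_i K i j = 0
    & forall i j, K i j * pi j 0 = K j i * pi i 0].

Definition bipartition (n : nat) (S T : {set 'I_n}) : Prop :=
  [/\ S != set0, T != set0, [disjoint S & T] & S :|: T = [set: 'I_n]].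

(* The submatrix A_{IJ}.  Matrices indexed by I x J are represented by
   'M_(#|I|, #|J|), where k : 'I_#|I| stands for the k-th element of I
   (enum_val lists I in increasing order). *)
Definition block (R : realType) (n : nat) (A : 'M[R]_n) (I J : {set 'I_n}) :
    'M[R]_(#|I|, #|J|) :=
  mxsub (@enum_val _ (mem I)) (@enum_val _ (mem J)) A.

Definition entrywise_nonneg (R : realType) (m n : nat) (A : 'M[R]_(m, n)) :
    Prop :=
  forall i j, 0 <= A i j.

Definition ones (R : realType) (n : nat) : 'cV[R]_n := const_mx 1.

Definition Mmx (R : realType) (n : nat) (K : 'M[R]_n) (S T : {set 'I_n}) :
    'M[R]_#|T| :=
  1%:M + block K T S *m (invmx (block K S S) ^+ 2) *m block K S T.

(* As S and T partition the index set, the four blocks determine V. *)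
Definition has_block_form (R : realType) (n : nat) (K : 'M[R]_n)
    (S T : {set 'I_n}) (V : 'M[R]_n) (VTT : 'M[R]_#|T|) : Prop :=
  let KSSi := invmx (block K S S) in
  let KST := block K S T in
  let KTS := block K T S in
  [/\ block V S S = KSSi *m KST *m VTT *m KTS *m KSSi,
      block V S T = - (KSSi *m KST *m VTT),
      block V T S = - (VTT *m KTS *m KSSi)
    & block V T T = VTT].

Arguments has_block_form {R n} K S T V VTT.

(* Main.v *)
(** With [A = K_SS], the matrix [- A^-1] is entrywise non-negative: if [u A <= 0]
    and [u] had a negative minimum, attained exactly on [J], then the columns of
    [A] in [J] would vanish outside [J] and sum to zero; detailed balance makes
    the rows in [J] vanish outside [J] too, so that [1_J^T A = 0], contradicting
    nonsingularity.  Hence all blocks of [V] are products of non-negative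
    matrices as soon as [V_TT >= 0].
    For the column sums, [1_n^T K = 0] gives [1_S^T = - 1_T^T K_TS A^-1], so the
    sums of [V] over the columns in [T] are [1_T^T M V_TT], and those over the
    columns in [S] are [- 1_T^T M V_TT K_TS A^-1]. *)
Require Import Defs.
From mathcomp Require Import all_boot all_order all_algebra.
From mathcomp Require Import reals.

Set Implicit Arguments.
Unset Strict Implicit.
Unset Printing Implicit Defensive.

Import Order.TTheory GRing.Theory Num.Theory.
Local Open Scope ring_scope.

Lemma subgenerator_min_principle (R : realFieldType) (m : nat) (A : 'M[R]_m)
    (p : 'I_m -> R) (u : 'rV[R]_m) :
  (forall i j, i != j -> 0 <= A i j) -> (forall j, \sum_i A i j <= 0) ->
  (forall i, 0 < p i) -> (forall i j, A i j * p j = A j i * p i) ->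
  A \in unitmx -> (forall j, (u *m A) 0 j <= 0) -> forall j, 0 <= u 0 j.
Proof.
move=> Aoff Acol p_gt0 Abal Aunit uA_le0 j0; rewrite leNgt; apply/negP => uj0.
have [k _ kmin] := arg_minP (fun i => u 0 i) (isT : xpredT j0).
have uk_lt0 : u 0 k < 0 by apply: le_lt_trans (kmin j0 isT) uj0.
pose J := [pred i | u 0 i == u 0 k].
(* Subtracting the minimum kills the diagonal term of each column [j] in [J] and leaves only
   non-negative ones. By this identity the sum is also at most 0, so every term vanishes. *)
have shift j : \sum_i (u 0 i - u 0 k) * A i j
    = (u *m A) 0 j - u 0 k * \sum_i A i j.
  rewrite mxE mulr_sumr -sumrB.
  by apply: eq_bigr => i _; rewrite mulrBl.
have terms_ge0 j : j \in J -> forall i, true -> 0 <= (u 0 i - u 0 k) * A i j.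
  move=> /eqP jJ i _; have [->|ij] := eqVneq i j; first by rewrite jJ subrr mul0r.
  by rewrite mulr_ge0 ?subr_ge0 ?kmin ?Aoff.
have kcol_ge0 j : 0 <= u 0 k * \sum_i A i j.
  by apply: mulr_le0 => //; apply: ltW.
have sum0 j : j \in J -> \sum_i (u 0 i - u 0 k) * A i j = 0.
  move=> jJ; apply/eqP; rewrite eq_le sumr_ge0 ?andbT; last exact: terms_ge0.
  by rewrite shift subr_le0 (le_trans (uA_le0 j)).
(* Since the shifted sum is 0, [u 0 k] times the column sum equals [(u *m A) 0 j <= 0]; it is also
   non-negative, and [u 0 k] is nonzero. *)
have col0 j : j \in J -> \sum_i A i j = 0.
  move=> jJ; apply/eqP; rewrite -(mulrI_eq0 _ (mulfI (ltr0_neq0 uk_lt0))).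
  rewrite eq_le kcol_ge0 andbT -subr_ge0 sub0r.
  by have /eqP := sum0 j jJ; rewrite shift subr_eq0 => /eqP <-; rewrite oppr_ge0.
have Aout i j : j \in J -> i \notin J -> A i j = 0.
  move=> jJ; rewrite inE => iJ.
  have /eqP := psumr_eq0P (terms_ge0 j jJ) (sum0 j jJ) (i := i) isT.
  by rewrite mulf_eq0 subr_eq0 (negPf iJ) => /eqP.
pose v : 'rV[R]_m := \row_i (i \in J)%:R.
(* For [j] in [J] the entry is the full column sum, by [Aout]; for [j] outside [J], balance turns
   [A j i = 0] into [A i j = 0]. *)
have vA0 : v *m A = 0.
  apply/rowP => j; rewrite !mxE; have [jJ|jJ] := boolP (j \in J).
    rewrite -[RHS](col0 j jJ); apply: eq_bigr => i _; rewrite mxE.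
    by have [_|iJ] := boolP (i \in J); rewrite ?mul1r // (Aout i j) ?mulr0.
  apply: big1 => i _; rewrite mxE; have [iJ|_] := boolP (i \in J); last first.
    by rewrite mul0r.
  have /eqP := Abal i j; rewrite (Aout j i) // mul0r mulf_eq0.
  by rewrite (gt_eqF (p_gt0 j)) orbF => /eqP ->; rewrite mulr0.
have := mulmxK Aunit v; rewrite vA0 mul0mx => /rowP/(_ k)/eqP.
by rewrite !mxE inE eqxx eq_sym oner_eq0.
Qed.

(** Each row [u] of [- invmx A] satisfies [u *m A <= 0], the product being minus a row of the
    identity, so the minimum principle applies row by row. *)
Lemma subgenerator_invmx_le0 (R : realFieldType) (m : nat) (A : 'M[R]_m)
    (p : 'I_m -> R) :
  (forall i j, i != j -> 0 <= A i j) -> (forall j, \sum_i A i j <= 0) ->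
  (forall i, 0 < p i) -> (forall i j, A i j * p j = A j i * p i) ->
  A \in unitmx -> forall i j, 0 <= (- invmx A) i j.
Proof.
move=> Aoff Acol p_gt0 Abal Aunit i j.
have -> : (- invmx A) i j = row i (- invmx A) 0 j by rewrite [RHS]mxE.
apply: (subgenerator_min_principle Aoff Acol p_gt0 Abal Aunit) => k.
by rewrite -row_mul mulNmx mulVmx // !mxE oppr_le0 ler0n.
Qed.

Lemma entrywise_nonneg_mulmx (R : realType) (m n q : nat) (A : 'M[R]_(m, n))
    (B : 'M[R]_(n, q)) :
  entrywise_nonneg A -> entrywise_nonneg B -> entrywise_nonneg (A *m B).
Proof.
by move=> A0 B0 i j; rewrite mxE; apply: sumr_ge0 => k _; apply: mulr_ge0.
Qed.

Section Bipartition.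
Variables (R : realType) (n : nat) (S T : {set 'I_n}).
Hypothesis hST : bipartition S T.

Lemma bipartition_enum_val (i : 'I_n) :
  (exists k : 'I_#|S|, i = enum_val k) \/ (exists k : 'I_#|T|, i = enum_val k).
Proof.
have [_ _ _ cover] := hST.
have : i \in S :|: T by rewrite cover inE.
case/setUP => iI; [left | right]; exists (enum_rank_in iI i);
  by rewrite enum_rankK_in.
Qed.

Lemma big_bipartition (F : 'I_n -> R) :
  \sum_i F i
  = \sum_(k < #|S|) F (enum_val k) + \sum_(k < #|T|) F (enum_val k).
Proof.
have [_ _ disj cover] := hST.
rewrite -!big_enum_val -bigU //.
by apply: eq_bigl => i; have := in_setT i; rewrite -cover !inE.
Qed.

Lemma entrywise_nonneg_blocks (A : 'M[R]_n) :
  entrywise_nonneg (block A S S) -> entrywise_nonneg (block A S T) ->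
  entrywise_nonneg (block A T S) -> entrywise_nonneg (block A T T) ->
  entrywise_nonneg A.
Proof.
move=> SS ST TS TT i j.
by have [[k ->]|[k ->]] := bipartition_enum_val i;
   have [[l ->]|[l ->]] := bipartition_enum_val j;
   [have := SS k l | have := ST k l | have := TS k l | have := TT k l];
   rewrite mxE.
Qed.

(** Used for [A := K], to express the ones vector on [S] through that on [T], and for [A := V], to
    compute its column sums. *)
Lemma colsum_block (A : 'M[R]_n) (J : {set 'I_n}) :
  colsub (@enum_val _ (mem J)) ((ones R n)^T *m A)
  = (ones R #|S|)^T *m block A S J + (ones R #|T|)^T *m block A T J.
Proof.
apply/rowP => j; rewrite !mxE big_bipartition.
by congr (_ + _); apply: eq_bigr => k _; rewrite !mxE.
Qed.

Lemma row_bipartition_eq (u v : 'rV[R]_n) :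
  colsub (@enum_val _ (mem S)) u = colsub (@enum_val _ (mem S)) v ->
  colsub (@enum_val _ (mem T)) u = colsub (@enum_val _ (mem T)) v -> u = v.
Proof.
move=> /rowP eS /rowP eT; apply/rowP => i.
by have [[k ->]|[k ->]] := bipartition_enum_val i;
   [have := eS k | have := eT k]; rewrite !mxE.
Qed.

End Bipartition.

Lemma colsub_ones (R : realType) (n : nat) (J : {set 'I_n}) :
  colsub (@enum_val _ (mem J)) (ones R n)^T = (ones R #|J|)^T.
Proof. by apply/rowP => j; rewrite !mxE. Qed.

Section RateConstantMatrix.
Variables (R : realType) (n : nat) (K : 'M[R]_n) (pi : 'cV[R]_n).
Hypotheses (hpi : in_open_simplex pi) (hK : rate_constant_matrix K pi).

Lemma offdiag_block_ge0 (I J : {set 'I_n}) :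
  [disjoint I & J] -> entrywise_nonneg (block K I J).
Proof.
move=> disj i j; rewrite mxE; have [Koff _ _] := hK; apply: Koff.
apply/eqP => eij; have := disjointFr disj (enum_valP i).
by rewrite eij enum_valP.
Qed.

Lemma colsum_rate_constant : (ones R n)^T *m K = 0.
Proof.
have [_ Kcol _] := hK; apply/rowP => j; rewrite !mxE -[RHS](Kcol j).
by apply: eq_bigr => i _; rewrite !mxE mul1r.
Qed.

(** [K_SS] inherits signs and balance from [K]. Its column sums are at most 0 because a full column
    of [K] sums to 0 and its part in [T] is non-negative. *)
Lemma invmx_block_le0 (S T : {set 'I_n}) :
  bipartition S T -> block K S S \in unitmx ->
  entrywise_nonneg (- invmx (block K S S)).
Proof.
move=> hST hSS; have [pi_gt0 _] := hpi; have [Koff Kcol Kbal] := hK.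
apply: (@subgenerator_invmx_le0 _ _ _ (fun k => pi (enum_val k) 0)) => //.
- by move=> i j ij; rewrite mxE Koff // (inj_eq enum_val_inj).
- move=> j; have := Kcol (enum_val j); rewrite (big_bipartition hST) => /eqP.
  rewrite addr_eq0 => /eqP KS.
  under eq_bigr do rewrite mxE.
  rewrite KS oppr_le0 sumr_ge0 // => k _.
  have [_ _ disj _] := hST; rewrite disjoint_sym in disj.
  by have := offdiag_block_ge0 disj k j; rewrite mxE.
- by move=> i j; rewrite !mxE Kbal.
Qed.

End RateConstantMatrix.

Theorem proposition3p2 (R : realType) (n : nat)
    (K : 'M[R]_n) (pi : 'cV[R]_n) (S T : {set 'I_n})
    (V : 'M[R]_n) (VTT : 'M[R]_#|T|)
    (hpi : in_open_simplex pi)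
    (hK : rate_constant_matrix K pi)
    (hST : bipartition S T)
    (hSS : block K S S \in unitmx)
    (hV : has_block_form K S T V VTT) :
  (entrywise_nonneg V <-> entrywise_nonneg VTT) /\
  ((ones R n)^T *m V = (ones R n)^T <->
   (ones R #|T|)^T *m Mmx K S T *m VTT = (ones R #|T|)^T).
Proof.
have [VSS VST VTS VTTe] := hV.
have [_ _ disj _] := hST.
have KST0 := offdiag_block_ge0 hK disj.
have KTS0 : entrywise_nonneg (block K T S).
  by apply: (offdiag_block_ge0 hK); rewrite disjoint_sym.
have Ki0 := invmx_block_le0 hpi hK hST hSS.
split.
  split=> [V0 i j|VTT0]; first by rewrite -VTTe mxE.
  apply: (entrywise_nonneg_blocks hST).
  (* Each factor [invmx (block K S S)] absorbs one minus sign; here the two signs cancel. *)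
  - have -> : block V S S = - invmx (block K S S) *m block K S T *m VTT
        *m block K T S *m - invmx (block K S S).
      by rewrite VSS !mulNmx mulmxN opprK.
    by do !apply: entrywise_nonneg_mulmx.
  - by rewrite VST -!mulNmx; do !apply: entrywise_nonneg_mulmx.
  - by rewrite VTS -mulmxN; do !apply: entrywise_nonneg_mulmx.
  - by rewrite VTTe.
have onesS : (ones R #|S|)^T
    = - ((ones R #|T|)^T *m block K T S *m invmx (block K S S)).
  have := colsum_block hST K S; rewrite (colsum_rate_constant hK).
  have -> : colsub (@enum_val _ (mem S)) (0 : 'rV[R]_n) = 0.
    by apply/rowP => j; rewrite !mxE.
  move=> /esym/eqP; rewrite addr_eq0 => /eqP onesK.
  by rewrite -[LHS](mulmxK hSS) onesK mulNmx.
have colT : colsub (@enum_val _ (mem T)) ((ones R n)^T *m V)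
    = (ones R #|T|)^T *m Mmx K S T *m VTT.
  rewrite (colsum_block hST) VST VTTe onesS /Mmx expr2.
  rewrite mulNmx mulmxN opprK mulmxDr mulmx1 mulmxDl addrC; congr (_ + _).
  by rewrite !mulmxA.
(* The block form says that the columns of [V] in [S] are those in [T] times [- K_TS K_SS^-1]. *)
have colS : colsub (@enum_val _ (mem S)) ((ones R n)^T *m V)
    = - (colsub (@enum_val _ (mem T)) ((ones R n)^T *m V)
         *m block K T S *m invmx (block K S S)).
  rewrite !(colsum_block hST) VSS VST VTS VTTe.
  by rewrite !mulmxN !mulmxDl !mulNmx opprD opprK !mulmxA.
split=> [V1|M1]; first by rewrite -colT V1 colsub_ones.
(* Once the sums over the columns in [T] are 1, [colS] and [onesS] force those over the columns in
   [S] to be 1. *)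
rewrite -colT in M1; apply: (row_bipartition_eq hST).
  by rewrite colS M1 colsub_ones -onesS.
by rewrite M1 colsub_ones.
Qed.
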